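(* Let $n\ge2$, $k\ge1$ be integers and $0<q<p<1$. For any integer $D\ge1$, suppose $$\frac{(p-q)^2}{q(1-p)}\le\frac1{2(D(D+1))^2}\left(\frac{k^2}n\wedge1\right).$$ Then $$\inf_{\widehat Z\in\mathbb R[A]^{n\times n}_{\le D}}\mathbb E_{A,\,M\sim\mathbb P_{\mathrm{SBM}(p,q)}}\big(\ell(\widehat Z,Z_M)\big)\ \ge\ \frac1k-\frac1{k^2}-\frac3n.$$ In particular, when $k\le\sqrt n$ and $\dfrac{n(p-q)^2}{k^2q(1-p)}\le\dfrac1{2(D(D+1))^2}$, the same lower bound holds.
   Context: The prior $\mathbb P_{\mathrm{SBM}(p,q)}$: sample $z\in[k]^n$ with $z_i$ i.i.d. uniform on $\{1,\dots,k\}$; set $M_{ii}=0$ and $M_{ij}=M_{ji}=p\,\mathbf 1(z_i=z_j)+q\,\mathbf 1(z_i\ne z_j)$ for $i\ne j$. The membership matrix $Z_M\in\{0,1\}^{n\times n}$ has $(Z_M)_{ii}=0$ and $(Z_M)_{ij}=\mathbf 1(z_i=z_j)=(M_{ij}-q)/(p-q)$ for $i\ne j$. Given $M$, one observes a symmetric $A\in\{0,1\}^{n\times n}$ with $A_{ii}=0$ and $A_{ij}=A_{ji}\sim\mathrm{Bernoulli}(M_{ij})$ independent over $1\le i<j\le n$. The expectation is over $M$ and $A$. The loss is $\ell(\widehat Z,Z)=\binom n2^{-1}\sum_{1\le i<j\le n}(\widehat Z_{ij}-Z_{ij})^2$. The notation $\widehat Z\in\mathbb R[A]^{n\times n}_{\le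 D}$ means every entry $\widehat Z_{ij}$ is a real polynomial of degree at most $D$ in the entries of $A$ (its coefficients may depend on $p,q,k,n$). $a\wedge b=\min(a,b)$. *)

(* Defs.v *)
From mathcomp Require Import all_boot all_order all_algebra.
From mathcomp Require Import classical_sets reals.
From mathcomp.multinomials Require Import mpoly.

Set Implicit Arguments.
Unset Strict Implicit.
Unset Printing Implicit Defensive.

Import Order.TTheory GRing.Theory Num.Theory.

Local Open Scope ring_scope.

Definition labels (n k : nat) := {ffun 'I_n -> 'I_k}.

(* Independent labels, each uniform on the k communities. *)
Definition labels_pmf (R : realType) (n k : nat) (z : labels n k) : R :=
  \prod_(i < n) (k%:R)^-1.

Definition sbm_mean (R : realType) (n k : nat) (p q : R) (z : labels n k) :
    'M[R]_n :=
  \matrix_(i, j) if i == j then 0 else if z i == z j then p else q.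

Definition membership (R : realType) (n k : nat) (z : labels n k) : 'M[R]_n :=
  \matrix_(i, j) if i == j then 0 else (z i == z j)%:R.

Definition adjacency (n : nat) (A : 'M[bool]_n) : bool :=
  (A^T == A) && [forall i, ~~ A i i].

(* Only the entries above the diagonal are drawn, independently, as Bernoulli
   variables; matrices which are not symmetric with null diagonal have
   probability 0. *)
Definition graph_pmf (R : realType) (n : nat) (M : 'M[R]_n) (A : 'M[bool]_n) :
    R :=
  if adjacency A then
    \prod_(ij : 'I_n * 'I_n | (ij.1 < ij.2)%N)
      (if A ij.1 ij.2 then M ij.1 ij.2 else 1 - M ij.1 ij.2)
  else 0.

Definition sbm_expectation (R : realType) (n k : nat) (p q : R)
    (f : labels n k -> 'M[bool]_n -> R) : R :=
  \sum_(z : labels n k) \sum_(A : 'M[bool]_n)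
    labels_pmf R z * graph_pmf (sbm_mean p q z) A * f z A.

Definition loss (R : realType) (n : nat) (Zhat Z : 'M[R]_n) : R :=
  ('C(n, 2)%:R)^-1 *
  \sum_(ij : 'I_n * 'I_n | (ij.1 < ij.2)%N)
    (Zhat ij.1 ij.2 - Z ij.1 ij.2) ^+ 2.

(* One polynomial per entry of the estimator, in n * n indeterminates: that of
   index [mxvec_index i j] stands for the entry (i, j) of A. *)
Definition poly_estimator (R : realType) (n : nat) :=
  'M[{mpoly R[n * n]}]_n.

Definition estimate (R : realType) (n : nat) (P : poly_estimator R n)
    (A : 'M[bool]_n) : 'M[R]_n :=
  \matrix_(i, j) (P i j).@[mxvec (map_mx (fun b : bool => b%:R) A) ord0].

(* [msize] is the total degree plus one, and 0 for the null polynomial. *)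
Definition low_degree (R : realType) (n D : nat) : set (poly_estimator R n) :=
  fun P => forall i j, (msize (P i j) <= D.+1)%N.

Definition risk (R : realType) (n k : nat) (p q : R) (P : poly_estimator R n) :
    R :=
  sbm_expectation p q
    (fun (z : labels n k) A => loss (estimate P A) (membership R z)).

Lemma membership_mean (R : realType) (n k : nat) (p q : R) (z : labels n k)
    (i j : 'I_n) : p != q -> i != j ->
  membership R z i j = (sbm_mean p q z i j - q) / (p - q).
Proof.
move=> pq ij; rewrite !mxE (negbTE ij); case: (z i == z j).
  by rewrite divff // subr_eq0.
by rewrite subrr mul0r.
Qed.

Lemma labels_pmf_sum1 (R : realType) (n k : nat) : (0 < k)%N ->
  \sum_(z : labels n k) labels_pmf R z = 1.
Proof.
move=> k0; rewrite /labels_pmf sumr_const card_ffun !card_ord prodr_const.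
rewrite card_ord -[LHS]mulr_natr natrX -exprMn mulVf ?expr1n //.
by rewrite pnatr_eq0 -lt0n.
Qed.

Lemma graph_pmf_sum1 (R : realType) (n : nat) (M : 'M[R]_n) :
  \sum_(A : 'M[bool]_n) graph_pmf M A = 1.
Proof.
pose F (ij : 'I_n * 'I_n) (b : bool) : R :=
  if b then M ij.1 ij.2 else 1 - M ij.1 ij.2.
pose up (ij : 'I_n * 'I_n) := (ij.1 < ij.2)%N.
have F1 : \prod_(ij | up ij) \sum_(b : bool) F ij b = 1.
  by apply: big1 => ij _; rewrite big_bool /F /= addrC subrK.
rewrite -[RHS]F1 (big_distr_big false) /= /graph_pmf -big_mkcond /=.
pose toA (f : {ffun 'I_n * 'I_n -> bool}) : 'M[bool]_n :=
  \matrix_(i, j) (if (i < j)%N then f (i, j)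
                  else if (j < i)%N then f (j, i) else false).
pose ofA (A : 'M[bool]_n) : {ffun 'I_n * 'I_n -> bool} :=
  [ffun ij => up ij && A ij.1 ij.2].
rewrite (reindex_onto toA ofA) /=; last first.
  move=> A /andP[/eqP At /forallP A0]; apply/matrixP => i j.
  rewrite !mxE !ffunE /up /=; case: (ltngtP i j) => //= [ji|ij].
    by rewrite -[in RHS]At mxE.
  by have -> : i = j; [apply/val_inj | rewrite (negbTE (A0 j))].
apply: eq_big => [f|f _]; last first.
  by apply: eq_bigr => -[i j] /= ij; rewrite mxE ij.
apply/andP/pffun_onP => [[_ /eqP <-]|[/fintype.subsetP fs _]].
  split; last by move=> b _.
  apply/fintype.subsetP => ij; rewrite unfold_in /= ffunE -[ij \in up]/(up ij).
  by case: (up ij).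
split.
  apply/andP; split.
    by apply/eqP/matrixP => i j; rewrite !mxE; case: ltngtP.
  by apply/forallP => i; rewrite mxE ltnn.
apply/eqP/ffunP => -[i j]; rewrite ffunE mxE /up /=.
case: ifPn => //= ij; apply/esym/negbTE/negP => fij.
have := fs (i, j); rewrite !inE /= fij => /(_ isT).
by rewrite unfold_in /= (negbTE ij).
Qed.

Lemma graph_pmf_ge0 (R : realType) (n k : nat) (p q : R) (z : labels n k)
    (A : 'M[bool]_n) : 0 <= q -> q <= p -> p <= 1 ->
  0 <= graph_pmf (sbm_mean p q z) A.
Proof.
move=> q0 qp p1; rewrite /graph_pmf; case: ifP => // _.
apply: prodr_ge0 => -[i j] /= ij; rewrite mxE.
have -> : (i == j) = false by apply/eqP => e; rewrite e ltnn in ij.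
have p0 := le_trans q0 qp; have q1 := le_trans qp p1.
by case: (z i == z j); case: (A i j); rewrite ?subr_ge0.
Qed.

Lemma risk_ge0 (R : realType) (n k : nat) (p q : R) (P : poly_estimator R n) :
  0 <= q -> q <= p -> p <= 1 -> 0 <= risk k p q P.
Proof.
move=> q0 qp p1; apply: sumr_ge0 => z _; apply: sumr_ge0 => A _.
rewrite !mulr_ge0 ?graph_pmf_ge0 ?invr_ge0 ?ler0n //.
  by apply: prodr_ge0 => i _; rewrite invr_ge0 ler0n.
by apply: sumr_ge0 => ij _; apply: sqr_ge0.
Qed.

Lemma risk_has_inf (R : realType) (n k D : nat) (p q : R) :
  0 <= q -> q <= p -> p <= 1 ->
  has_inf [set risk k p q P | P in @low_degree R n D]%classic.
Proof.
move=> q0 qp p1; split.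
  by exists (risk k p q (0 : poly_estimator R n)); exists 0 => // i j;
    rewrite mxE msize0.
by exists 0 => _ [P _ <-]; apply: risk_ge0.
Qed.

(* Main.v *)
Require Import Defs.
From mathcomp Require Import all_boot all_order all_algebra all_fingroup.
From mathcomp Require Import classical_sets reals.
From mathcomp Require Import fintype finset.
From mathcomp.multinomials Require Import mpoly.
From mathcomp Require Import ring lra zify.

(* A dual certificate. For a fixed pair [(i, j)] write x = 1(z_i = z_j). If a
   random variable g(z, A) satisfies E[f g] = E[f x] for every polynomial f(A)
   of degree at most D, then expanding E[(f - g)^2] >= 0 gives
   E[(f - x)^2] >= E[x^2] - E[g^2] = 1/k - E[g^2].
   Take g = sum_S (p - q)^|S| c_S prod_(e in S) (A_e - M_e) / (M_e (1 - M_e)),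
   over edge sets S with at most D edges. Given z the products are orthogonal,
   and E[prod_(e in T) (A_e - q) prod_(e in S) (...) | z] is
   prod_(e in T \ S) (M_e - q) if S is contained in T, and 0 otherwise. Hence
   the moment conditions become a triangular system for the c_S, whose data are
   the probabilities that all edges of a set are monochromatic. Its solution
   satisfies |c_S| <= 2 |S|^|S| k^-(v-1), where v is the number of vertices of
   S with i and j added, and vanishes unless S is connected and contains i and
   j (or is empty); in particular v - 1 <= |S|. Counting the edge sets with
   given |S| and v yields E[g^2] <= 1/k^2 + 2/n. *)

Set Implicit Arguments.
Unset Strict Implicit.
Unset Printing Implicit Defensive.

Import Order.TTheory GRing.Theory Num.Theory.

Local Open Scope ring_scope.

(** * Probabilities of monochromatic edge sets *)

Local Notation edge n := ('I_n * 'I_n)%type.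

(* Labellings are vectors over Z/k, so that those for which all edges of [T] are
   monochromatic form a subgroup, and [mul_cardG] counts intersections. *)
Definition mono n k (T : {set edge n}) : {set 'rV['I_k.+1]_n} :=
  [set z : 'rV['I_k.+1]_n | [forall e in T, z ord0 e.1 == z ord0 e.2]].

Lemma monoP n k (T : {set edge n}) (z : 'rV['I_k.+1]_n) :
  reflect (forall e, e \in T -> z ord0 e.1 = z ord0 e.2) (z \in mono k T).
Proof.
rewrite inE; apply: (iffP forallP) => [H e eT|H e].
  by have /implyP/(_ eT)/eqP := H e.
by apply/implyP => /H ->.
Qed.

Lemma mono_group_set n k (T : {set edge n}) : group_set (mono k T).
Proof.
apply/group_setP; split=> [|x y /monoP Hx /monoP Hy].
  by apply/monoP => e _; rewrite FinRing.zmod1gE !mxE.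
by apply/monoP => e eT; rewrite FinRing.zmodMgE !mxE Hx ?Hy.
Qed.
Canonical mono_group n k T := Group (@mono_group_set n k T).

Lemma monoU n k (S T : {set edge n}) :
  mono k (S :|: T) = mono k S :&: mono k T.
Proof.
apply/setP => z; rewrite in_setI; apply/monoP/andP => [H|[/monoP HS /monoP HT]].
  by split; apply/monoP => e eS; apply: H; rewrite inE eS ?orbT.
by move=> e; rewrite inE => /orP[/HS|/HT].
Qed.

Lemma card_colourings n k : #|{: 'rV['I_k.+1]_n}| = (k.+1 ^ n)%N.
Proof. by rewrite card_mx card_ord mul1n. Qed.

(** The product set of the two subgroups has at most [k.+1 ^ n] elements, and their intersection is
    [mono k (S :|: T)]. This is positive correlation of monochromatic events. *)
Lemma card_mono_mul n k (S T : {set edge n}) :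
  (#|mono k S| * #|mono k T| <= k.+1 ^ n * #|mono k (S :|: T)|)%N.
Proof.
by rewrite mul_cardG monoU leq_mul2r -card_colourings max_card orbT.
Qed.

(** Here the product set is everything, so correlation becomes independence. The factorisations
    below only have to exhibit the decomposition [z = x + (z - x)]. *)
Lemma card_mono_mul_eq n k (S T : {set edge n}) :
  (forall z : 'rV['I_k.+1]_n, exists2 x, x \in mono k S & z - x \in mono k T) ->
  (#|mono k S| * #|mono k T| = k.+1 ^ n * #|mono k (S :|: T)|)%N.
Proof.
move=> H; rewrite mul_cardG monoU -card_colourings.
rewrite (_ : (mono k S * mono k T)%g = [set: 'rV_n]) ?cardsT //.
apply/setP => z; rewrite in_setT; have [x xS zx] := H z.
by apply/mulsgP; exists x (z - x) => //; rewrite FinRing.zmodMgE addrC subrK.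
Qed.

Definition mono_prob (R : realType) n k (T : {set edge n}) : R :=
  #|mono k T|%:R / (k.+1%:R ^+ n).

Section Mprob.
Context (R : realType) (n k : nat).
Implicit Types S T : {set edge n}.
Local Notation m := (@mono_prob R n k).

Lemma kn_gt0 : 0 < (k.+1%:R ^+ n : R).
Proof. by rewrite exprn_gt0. Qed.

Lemma mono_prob_ge0 T : 0 <= m T.
Proof. by rewrite divr_ge0 // exprn_ge0. Qed.

Lemma mono_prob0 : m set0 = 1.
Proof.
rewrite /mono_prob (_ : mono k set0 = setT) ?cardsT ?card_colourings ?natrX.
  by rewrite divff ?gt_eqF ?kn_gt0.
by apply/setP => z; rewrite in_setT; apply/monoP => e; rewrite inE.
Qed.

Lemma mono_prob_mul_le S T : m S * m T <= m (S :|: T).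
Proof.
rewrite /mono_prob mulrACA -invfM ler_pdivrMr ?mulr_gt0 ?kn_gt0 //.
rewrite mulrA divfK ?gt_eqF ?kn_gt0 // -natrX -!natrM ler_nat mulnC
  [leqRHS]mulnC.
by rewrite mulnC card_mono_mul.
Qed.

Lemma mono_prob_mul_eq S T :
  (forall z : 'rV['I_k.+1]_n, exists2 x, x \in mono k S & z - x \in mono k T) ->
  m (S :|: T) = m S * m T.
Proof.
move=> H; rewrite /mono_prob mulrACA -invfM -natrM card_mono_mul_eq // natrM
  natrX.
by rewrite -mulf_div divff ?mul1r ?gt_eqF ?kn_gt0.
Qed.

Lemma mono_probS S T : S \subset T -> m T <= m S.
Proof.
move=> ST; rewrite ler_pM2r ?invr_gt0 ?kn_gt0 // ler_nat;
  apply: subset_leq_card.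
by apply/subsetP => z /monoP H; apply/monoP => e eS;
  apply/H/(fintype.subsetP ST).
Qed.

Definition within (C : {set 'I_n}) T :=
  forall e, e \in T -> e.1 \in C /\ e.2 \in C.

(** Zeroing [z] on [C] gives a labelling constant on [C]; what remains vanishes off [C]. *)
Lemma mono_prob_split S T (C : {set 'I_n}) : within C S -> within (~: C) T ->
  m (S :|: T) = m S * m T.
Proof.
move=> HS HT; apply: mono_prob_mul_eq => z.
exists (\row_j if j \in C then 0 else z ord0 j).
  by apply/monoP => e /HS[e1 e2]; rewrite !mxE e1 e2.
apply/monoP => e /HT[]; rewrite !inE !mxE => /negbTE -> /negbTE ->.
by rewrite !subrr.
Qed.

(** Adding an arbitrary shift to the label of [i] is a bijection from pairs (shift, labelling that
    agrees on [i] and [j]) onto all labellings. *)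
Lemma mono_prob_edge (i j : 'I_n) : i != j -> m [set (i, j)] = k.+1%:R^-1.
Proof.
move=> ij; pose f (az : 'I_k.+1 * 'rV['I_k.+1]_n) :=
  \row_l (if l == i then az.1 + az.2 ord0 l else az.2 ord0 l).
have f_inj : {in setX setT (mono k [set (i, j)]) &, injective f}.
  move=> [a x] [b y] /setXP[_ /monoP Hx] /setXP[_ /monoP Hy] /rowP fE.
  have xi := Hx (i, j) (set11 _); have yi := Hy (i, j) (set11 _).
  have xy l : x ord0 l = y ord0 l.
    have [->|li] := eqVneq l i.
      by have := fE j; rewrite !mxE eq_sym (negbTE ij) /= in xi yi *;
        rewrite xi yi.
    by have := fE l; rewrite !mxE (negbTE li).
  have := fE i; rewrite !mxE eqxx /= xy => /addIr ->.
  by congr pair; apply/rowP.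
have f_im : f @: setX setT (mono k [set (i, j)]) = setT.
  apply/setP => z; rewrite in_setT; apply/imsetP.
  exists (z ord0 i - z ord0 j, \row_l z ord0 (if l == i then j else l)).
    rewrite in_setX in_setT; apply/monoP => e /set1P -> /=.
    by rewrite !mxE eqxx; case: ifP.
  apply/rowP => l; rewrite !mxE /=; have [->|//] := eqVneq l i.
  by rewrite subrK.
have := card_in_imset f_inj; rewrite f_im cardsT card_colourings cardsX cardsT.
rewrite card_ord => /(congr1 (fun a => a%:R : R)).
rewrite natrM natrX /mono_prob => ->.
by rewrite invfM mulrCA divff ?mulr1 // pnatr_eq0 -lt0n cardG_gt0.
Qed.

(** No edge of [T] leaves [C], so a constant shift on [C] respects [T]; the shift by [z_i - z_j]
    absorbs the disagreement of [i] and [j]. *)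
Lemma mono_prob_cross i j T (C : {set 'I_n}) : i \in C -> j \notin C ->
  (forall e, e \in T -> (e.1 \in C) = (e.2 \in C)) ->
  m ((i, j) |: T) = m [set (i, j)] * m T.
Proof.
move=> iC jC HT; rewrite setUC mulrC; apply: mono_prob_mul_eq => z.
exists (\row_l if l \in C then z ord0 i - z ord0 j else 0).
  by apply/monoP => e /HT eC; rewrite !mxE eC.
apply/monoP => e; rewrite inE => /eqP -> /=; rewrite !mxE iC (negbTE jC).
by rewrite opprB subr0 addrC subrK.
Qed.

(** Edges are added one at a time; by positive correlation each costs at most a factor [k.+1]. *)
Lemma mono_prob_ge_inv T : k.+1%:R ^- #|T| <= m T.
Proof.
have [d] := ubnP #|T|; elim: d T => // d IH T; rewrite ltnS => Td.
have [->|[[i j] ijT]] := set_0Vmem T;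
  first by rewrite cards0 mono_prob0 expr0 invr1.
rewrite -(setD1K ijT); apply: le_trans (mono_prob_mul_le _ _).
rewrite setD1K // (cardsD1 (i, j)) ijT exprS invfM ler_pM ?invr_ge0 ?exprn_ge0
  //.
  (* [T] is any set of ordered pairs, so it may contain a loop [(i, i)], which constrains
     nothing. *)
  have [->|/mono_prob_edge ->//] := eqVneq i j.
  rewrite (_ : m _ = 1) ?invf_le1 ?ler1n //.
  rewrite -mono_prob0 /mono_prob; congr (#|pred_of_set _|%:R / _);
    apply/setP => z.
  by apply/monoP/monoP => _ e => [|/set1P ->]; rewrite ?inE.
by apply: IH; rewrite (cardsD1 (i, j)) ijT in Td.
Qed.

(** A tree that encodes the event that [i] and all of [W] share one colour; being a tree, it has a
    probability that is an exact power of [k.+1]. *)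
Definition star (i : 'I_n) (W : {set 'I_n}) : {set edge n} :=
  [set (i, j) | j in W :\ i].

(** Every [j] in [W :\ i] is a leaf, and [mono_prob_cross] with the complement of [j] splits off its
    edge. *)
Lemma mono_prob_star i W : m (star i W) = k.+1%:R ^- #|W :\ i|.
Proof.
have [d] := ubnP #|W|; elim: d W => // d IH W; rewrite ltnS => Wd.
have [W0|[j jW]] := set_0Vmem (W :\ i).
  by rewrite /star W0 imset0 mono_prob0 cards0 expr0 invr1.
have /setD1P[ji jW'] := jW.
have -> : star i W = (i, j) |: star i (W :\ j).
  apply/setP => -[x y]; rewrite !inE; apply/imsetP/orP.
    case=> l; rewrite !inE => /andP[li lW] [-> ->].
    have [->|lj] := eqVneq l j; [by left; rewrite eqxx|right].
    by apply/imsetP; exists l => //; rewrite !inE li lj.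
  case=> [/eqP[-> ->]|/imsetP[l]]; first by exists j.
  by rewrite !inE => /and3P[li _ lW] ->; exists l; rewrite // !inE li.
rewrite (@mono_prob_cross _ _ _ (~: [set j])) ?inE ?eqxx //.
- rewrite IH ?mono_prob_edge 1?eq_sym //; last by rewrite (cardsD1 j) jW' in Wd.
  rewrite (cardsD1 j (W :\ i)) jW exprS invfM;
    congr (_ * _ ^- #|pred_of_set _|).
  by apply/setP => x; rewrite !inE andbCA.
- by rewrite eq_sym.
- move=> e /imsetP[l]; rewrite !inE => /and3P[_ lj _] -> /=.
  by rewrite lj eq_sym ji.
Qed.

End Mprob.

(** * Cumulants: existence, vanishing and size *)

(* With [m], [h] the moments of the edge indicators without and with the
   target pair, [c T] is the joint cumulant-like coefficient that a dual
   certificate of degree [#|T|] must carry; it vanishes on factorising sets. *)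
Lemma cumulants_exist (R : comNzRingType) (I : finType) (m h : {set I} -> R) :
  m set0 = 1 ->
  exists c : {set I} -> R, forall T : {set I},
    \sum_(S : {set I} | S \subset T) c S * m (T :\: S) = h T.
Proof.
move=> m0.
suff /(_ #|I|.+1)[c Hc] : forall N,
    exists c : {set I} -> R, forall T : {set I}, (#|T| < N)%N ->
    \sum_(S : {set I} | S \subset T) c S * m (T :\: S) = h T.
  by exists c => T; apply: Hc; rewrite ltnS max_card.
elim=> [|N [c Hc]]; first by exists (fun=> 0).
exists (fun T : {set I} => if (#|T| < N)%N then c T else
  h T - \sum_(S : {set I} | S \proper T) c S * m (T :\: S)) => T.
rewrite ltnS leq_eqVlt => /orP[/eqP TN|TN]; last first.
  rewrite -(Hc T TN); apply: eq_bigr => S ST.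
  by rewrite (leq_ltn_trans (subset_leq_card ST) TN).
rewrite (bigD1 T) //= TN ltnn setDv m0 mulr1 -addrA addrC.
apply/eqP; rewrite eq_sym -subr_eq subrr eq_sym addrC subr_eq0; apply/eqP.
apply: eq_big => S; first by rewrite properEneq andbC.
move=> /andP[ST SnT]; rewrite -TN proper_card //.
by rewrite properEneq SnT.
Qed.

(** Strong induction on the size of [S1 :|: S2] with [S2] nonempty. In the equation for this union,
    the terms with [S] inside [S1] already sum to [h S1 * m S2], the whole right-hand side. The
    other terms vanish by induction, except the one carrying [c (S1 :|: S2)]. *)
Lemma cumulant_factor (R : comNzRingType) (I : finType) (m h c : {set I} -> R)
    (T1 T2 : {set I}) :
  m set0 = 1 ->
  (forall T : {set I},
    \sum_(S : {set I} | S \subset T) c S * m (T :\: S) = h T) ->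
  [disjoint T1 & T2] -> T2 != set0 ->
  (forall S1 S2 : {set I}, S1 \subset T1 -> S2 \subset T2 ->
    h (S1 :|: S2) = h S1 * m S2) ->
  (forall S1 S2 : {set I}, S1 \subset T1 -> S2 \subset T2 ->
    m (S1 :|: S2) = m S1 * m S2) ->
  c (T1 :|: T2) = 0.
Proof.
move=> m0 Hc T12 T2n Hh Hm.
suff H d : forall S1 S2 : {set I}, S1 \subset T1 -> S2 \subset T2 -> S2 !=
  set0 ->
    (#|S1 :|: S2| < d)%N -> c (S1 :|: S2) = 0.
  exact: (H #|T1 :|: T2|.+1).
elim: d => // d IH S1 S2 S1T S2T S2n; rewrite ltnS => Sd.
have dis : [disjoint S1 & S2] by apply: disjointWl S1T (disjointWr S2T T12).
have := Hc (S1 :|: S2); rewrite Hh // -(Hc S1).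
rewrite (bigID (fun S : {set I} => S \subset S1)) /= mulr_suml.
rewrite (eq_bigl (fun S : {set I} => S \subset S1)); last first.
  move=> S; case SS: (S \subset S1); rewrite ?andbF // andbT.
  exact: subset_trans SS (subsetUl _ _).
rewrite (eq_bigr (fun S => c S * m (S1 :\: S) * m S2)); last first.
  move=> S SS; rewrite -mulrA -Hm ?(subset_trans (subsetDl _ _)) //.
  rewrite setDUl [S2 :\: S](setDidPl _) //.
  by rewrite disjoint_sym; apply: disjointWl SS dis.
move/eqP; rewrite addrC -subr_eq0 addrK => /eqP;
  rewrite (bigD1 (S1 :|: S2)) /=; last first.
  rewrite subxx subUset subxx /=; apply: contra S2n => S21.
  rewrite -subset0 -(setIidPl S21) setIC.
  by move: dis; rewrite -setI_eq0 => /eqP ->.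
rewrite setDv m0 mulr1 big1 ?addr0 // => S /andP[/andP[SS SnS1] SnS].
suff -> : c S = 0 by rewrite mul0r.
have SE : S = (S :&: S1) :|: (S :&: S2) by rewrite -setIUr; apply/esym/setIidPl.
rewrite SE; apply: IH; rewrite -?SE.
- by rewrite (subset_trans (subsetIr _ _)).
- by rewrite (subset_trans (subsetIr _ _)).
- by apply: contra SnS1 => /eqP SS2; rewrite SE SS2 setU0 subsetIr.
- by apply: leq_trans Sd; rewrite proper_card // properEneq SnS.
Qed.

Lemma sum_subset_expr (R : comNzRingType) (I : finType) (T : {set I}) (a : R) :
  \sum_(S : {set I} | S \subset T) a ^+ #|S| = (1 + a) ^+ #|T|.
Proof.
rewrite big_mkcond -prodr_const [RHS]big_mkcond /=.
rewrite (eq_bigr (fun i => (if i \in T then a else 0) + 1)); last first.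
  by move=> i _; case: ifP; rewrite ?add0r // addrC.
rewrite bigA_distr; apply: eq_big => // S _.
rewrite -big_mkcond /=; case: ifPn => [ST|/subsetPn[x xS xT]].
  rewrite -prodr_const; apply: eq_bigr => i iS.
  by rewrite (subsetP ST).
by rewrite (bigD1 x) //= (negbTE xT) mul0r.
Qed.

(** Solve the equation of [T] for [c T] and insert the bound for proper subsets; the hypothesis
    [h S * m (T :\: S) <= h T] turns every term into a multiple of [h T]. *)
Lemma cumulant_bound (R : realFieldType) (I : finType) (m h c : {set I} -> R) :
  m set0 = 1 -> (forall T, 0 <= m T) -> (forall T, 0 <= h T) ->
  (forall S T : {set I}, S \subset T -> h S * m (T :\: S) <= h T) ->
  (forall T : {set I},
    \sum_(S : {set I} | S \subset T) c S * m (T :\: S) = h T) ->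
  forall T : {set I}, T != set0 -> `|c T| <= 2 * #|T|%:R ^+ #|T| * h T.
Proof.
move=> m0 mge0 hge0 hm Hc T.
have c0 : c set0 = h set0.
  rewrite -(Hc set0) (eq_bigl (pred1 set0)) ?big_pred1_eq ?setDv ?m0 ?mulr1 //
    => S.
  by rewrite subset0.
have [d] := ubnP #|T|; elim: d T => // d IH T; rewrite ltnS => Td Tn.
have T0 : (0 < #|T|)%N by rewrite card_gt0.
have cE : c T = h T - \sum_(S : {set I} | S \proper T) c S * m (T :\: S).
  rewrite -(Hc T) (bigD1 T) //= setDv m0 mulr1 [X in _ + X - _](eq_bigl (fun S
    : {set I} => S \proper T)) ?addrK // => S.
  by rewrite properEneq andbC.
have h0T : h set0 * m T <= h T by have := hm _ _ (sub0set T); rewrite setD0.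
have setTn : set0 \proper T by rewrite proper0.
(* For proper [S], [#|S| ^ #|S|] is at most [(#|T| - 1) ^ #|S|], and the sum of the latter is part
   of the binomial expansion of [#|T| ^ #|T|]. The term of the empty set, doubled, pays for both
   [h T] and [c set0 * m T]. *)
apply: (@le_trans _ _ (2 * (\sum_(S : {set I} | S \proper T) (#|T|.-1)%:R ^+
  #|S|) * h T)); last first.
  rewrite ler_wpM2r // ler_wpM2l //.
  have := sum_subset_expr T (#|T|.-1%:R : R).
  rewrite nat1r prednK // (bigD1 T) //= => <-.
  rewrite [X in _ + X](eq_bigl (fun S : {set I} => S \proper T)) => [|S];
    last by rewrite properEneq andbC.
  by rewrite lerDr exprn_ge0.
rewrite cE (bigD1 set0) //= [in leRHS](bigD1 set0) //= cards0 expr0 setD0.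
rewrite mulrDr mulrDl mulr1 opprD addrA.
apply: le_trans (ler_normB _ _) _; apply: lerD.
  apply: le_trans (ler_normB _ _) _; rewrite mulr_natl mulr2n c0.
  by rewrite !ger0_norm ?mulr_ge0 // lerD.
rewrite mulr_sumr mulr_suml; apply: le_trans (ler_norm_sum _ _ _) _.
apply: ler_sum => S /andP[ST Sn]; rewrite normrM (ger0_norm (mge0 _)).
have SdT : (#|S| < #|T|)%N by apply: proper_card.
apply: (@le_trans _ _ (2 * #|S|%:R ^+ #|S| * h S * m (T :\: S))).
  by rewrite ler_wpM2r // IH // (leq_trans SdT).
rewrite -mulrA ler_pM ?mulr_ge0 ?exprn_ge0 // ?hm ?proper_sub //.
rewrite ler_wpM2l // lerXn2r ?nnegrE // ler_nat.
by case: #|T| SdT.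
Qed.

(** * Cumulants are supported on connected edge sets *)

Definition verts n (i j : 'I_n) (T : {set edge n}) : {set 'I_n} :=
  [set i; j] :|: [set e.1 | e in T] :|: [set e.2 | e in T].

Section Connected.
Context (R : realType) (n k : nat) (i j : 'I_n).
Context (c : {set edge n} -> R).
Hypothesis c_eq : forall T : {set edge n},
  \sum_(S : {set edge n} | S \subset T) c S * mono_prob R k (T :\: S) =
    mono_prob R k ((i, j) |: T).

(** A nonzero cumulant forces [T] to be connected through [i] and [j], so colours propagate from [i]
    along paths. Connectivity does not involve colours, hence the free number [K]: it is used with
    two colours to count edges and with [k.+1] to bound probabilities. *)
Lemma cumulant_neq0_mono (K : nat) (T : {set edge n}) :
  c T != 0 -> T != set0 -> mono K T \subset mono K (star i (verts i j T)).
Proof.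
move=> cT Tn.
pose adj : rel 'I_n := [rel x y | ((x, y) \in T) || ((y, x) \in T)].
pose C := [set x | connect adj i x].
have csym : connect_sym adj.
  by apply: sym_connect_sym => x y; rewrite /adj /= orbC.
have iC : i \in C by rewrite inE.
have CT e : e \in T -> (e.1 \in C) = (e.2 \in C).
  case: e => x y xyT; rewrite !inE; apply: (same_connect_r csym).
  by apply: connect1; rewrite /adj /= xyT.
(* Otherwise the pair [(i, j)] is independent of [T], and [cumulant_factor] applies with an empty
   first set. *)
have jC : j \in C.
  apply: contraR cT => jC; rewrite -[T]set0U.
  apply/eqP/(cumulant_factor (mono_prob0 R n k) c_eq) => // [|S1 S2|S1 S2].
  - by rewrite -setI_eq0 set0I.
  - rewrite subset0 => /eqP -> ST; rewrite setU0 set0U.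
    apply: (mono_prob_cross R k iC jC) => e eS; exact/CT/(subsetP ST).
  - by rewrite subset0 => /eqP -> _; rewrite set0U mono_prob0 mul1r.
(* Otherwise the edges outside the component of [i] form a nonempty factor, independent of the rest
   and of [(i, j)]. *)
have TC : within C T.
  pose T1 := [set e in T | e.1 \in C]; pose T2 := [set e in T | e.1 \notin C].
  have TE : T1 :|: T2 = T.
    by apply/setP => e; rewrite !inE -andb_orr orbN andbT.
  have [T20|T2n] := eqVneq T2 set0.
    move=> e eT; rewrite -(CT e eT).
    have : e \in T1 by move: eT; rewrite -[in X in X -> _]TE T20 setU0.
    by rewrite inE => /andP[].
  case/eqP: cT; rewrite -TE.
  have T1C (S1 : {set edge n}) : S1 \subset T1 -> within C S1.
    move=> ST e /(subsetP ST); rewrite inE => /andP[eT eC].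
    by rewrite -(CT _ eT).
  have T2C (S2 : {set edge n}) : S2 \subset T2 -> within (~: C) S2.
    move=> ST e /(subsetP ST); rewrite inE => /andP[eT eC].
    by rewrite !in_setC -(CT _ eT).
  apply: (cumulant_factor (mono_prob0 R n k) c_eq) => // [|S1 S2 S1T S2T|S1 S2
    S1T S2T].
  - by rewrite -setI_eq0; apply/eqP/setP => e; rewrite !inE; case: (_ \in T);
    case: (connect _ _ _).
  - rewrite setUA; apply: mono_prob_split _ _ (T2C _ S2T) => e /setU1P[->//|].
    exact: T1C.
  - exact: mono_prob_split _ _ (T1C _ S1T) (T2C _ S2T).
apply/subsetP => z /monoP Hz.
have zC x : x \in C -> z ord0 i = z ord0 x.
  rewrite inE => /connectP[s]; elim: s i => [a _ -> //|b s IH a /= /andP[ab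
    bs] xl].
  rewrite -(IH b) //.
  by case/orP: ab => /Hz /= ->.
apply/monoP => e /imsetP[x]; rewrite !inE => /andP[xi xW] -> /=; apply: zC.
case/orP: xW => [/orP[/orP[/eqP->|/eqP->]//|]|] /imsetP[e' /TC[e1 e2] ->] //.
Qed.

Lemma card_verts_star T : #|verts i j T :\ i| = #|verts i j T|.-1.
Proof. by rewrite [in RHS](cardsD1 i) !inE eqxx. Qed.

(* Two-colourings: those monochromatic on [T] are constant on [verts i j T],
   while each edge at most halves their number. *)
Lemma card_verts_le (T : {set edge n}) :
  c T != 0 -> T != set0 -> (#|verts i j T|.-1 <= #|T|)%N.
Proof.
move=> cT Tn; rewrite -card_verts_star.
have := mono_prob_ge_inv R 1 T.
have : mono_prob R 1 T <= mono_prob R 1 (star i (verts i j T)).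
  rewrite ler_pM2r ?invr_gt0 ?kn_gt0 // ler_nat.
  exact/subset_leq_card/cumulant_neq0_mono.
rewrite mono_prob_star => H1 H2; have := le_trans H2 H1.
by rewrite lef_pV2 ?posrE ?exprn_gt0 // ler_eXn2l // ltr1n.
Qed.

(** Positive correlation supplies the hypothesis of [cumulant_bound]; the moment of [(i, j) |: T] is
    then at most the probability that all of [verts i j T] has one colour. *)
Lemma cumulant_le (T : {set edge n}) : T != set0 ->
  `|c T| <= 2 * #|T|%:R ^+ #|T| * k.+1%:R ^- #|verts i j T|.-1.
Proof.
move=> Tn; have [->|cT] := eqVneq (c T) 0.
  by rewrite normr0 !mulr_ge0 ?invr_ge0 ?exprn_ge0.
apply: le_trans (cumulant_bound (mono_prob0 R n k) _ _ _ c_eq Tn) _.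
- exact: mono_prob_ge0.
- by move=> S; apply: mono_prob_ge0.
- move=> S S' SS; apply: le_trans (mono_prob_mul_le _ _ _ _) _.
  rewrite -setUA (_ : S :|: _ = S') //.
  apply/setP => e; rewrite !inE; case eS: (e \in S) => //=.
  by rewrite (subsetP SS).
rewrite ler_wpM2l ?mulr_ge0 ?exprn_ge0 // -card_verts_star -mono_prob_star.
apply: le_trans (mono_probS _ _ (subsetUr _ _)) _.
rewrite ler_pM2r ?invr_gt0 ?kn_gt0 // ler_nat.
exact/subset_leq_card/cumulant_neq0_mono.
Qed.

End Connected.

(** * Counting edge sets and summing squared cumulants *)

Definition upper n : {set edge n} := [set e : edge n | (e.1 < e.2)%N].

Lemma bin_le_expn n m : ('C(n, m) <= n ^ m)%N.
Proof.
have : (n ^_ m <= n ^ m)%N.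
  by elim: m => // m IH; rewrite ffactnSr expnSr leq_mul ?leq_subr.
by apply: leq_trans; rewrite -bin_ffact leq_pmulr // fact_gt0.
Qed.

Lemma card_bigcup_le (I T : finType) (P : pred I) (F : I -> {set T}) :
  (#|\bigcup_(i | P i) F i| <= \sum_(i | P i) #|F i|)%N.
Proof.
elim/big_rec2: _ => [|i a A _ AB]; first by rewrite cards0.
by apply: leq_trans (leq_card_setU _ _) _; rewrite leq_add2l.
Qed.

Lemma card_upper_within n (W : {set 'I_n}) :
  #|[set e in upper n | (e.1 \in W) && (e.2 \in W)]| = 'C(#|W|, 2).
Proof.
set U := [set e in _ | _].
pose f (e : edge n) := [set e.1; e.2].
have f_inj : {in U &, injective f}.
  move=> [a b] [x y]; rewrite !inE /= => /andP[ab _] /andP[xy _] /setP fE.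
  have /set2P[ax|ay] : a \in [set x; y] by rewrite -(fE a) set21.
    have /set2P[bx|->] : b \in [set x; y] by rewrite -(fE b) set22.
      by rewrite ax bx ltnn in ab.
    by rewrite ax.
  have /set2P[bx|bY] : b \in [set x; y] by rewrite -(fE b) set22.
    by move: ab; rewrite ay bx ltnNge (ltnW xy).
  by rewrite ay bY ltnn in ab.
rewrite -(card_in_imset f_inj) -cards_draws; congr #|pred_of_set _|.
apply/setP => B; rewrite inE; apply/imsetP/andP => [[[a b]]|[BW /cards2P[a [b
  [ab BE]]]]].
  rewrite !inE /f /= => /andP[ab /andP[aW bW]] ->.
  split; first by apply/subsetP => x /set2P[] ->.
  have /negbTE nab : a != b by apply: contraTneq ab => ->; rewrite ltnn.
  by rewrite cards2 nab.
rewrite {B}BE in BW *.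
wlog lt_ab : a b ab BW / (a < b)%N => [H|].
  have [lt_ab|lt_ba|ab'] := ltngtP a b.
  - exact: (H a b ab BW lt_ab).
  - by rewrite setUC; apply: H => //; rewrite 1?eq_sym 1?setUC.
  - by rewrite -(inj_eq val_inj) /= ab' eqxx in ab.
exists (a, b) => //; rewrite !inE /= lt_ab.
by move: BW; rewrite subUset !sub1set.
Qed.

(** Choose the [v] vertices other than [i] and [j], then [d] of the pairs inside the resulting
    vertex set. *)
Lemma card_edge_sets_le n (i j : 'I_n) d v : i != j ->
  (#|[set T : {set edge n} |
        [&& T \subset upper n, #|T| == d & #|verts i j T| == v.+2]]|
    <= n ^ v * 'C(v.+2, 2) ^ d)%N.
Proof.
move=> ij.
pose Ws := [set W : {set 'I_n} | [&& i \in W, j \in W & #|W| == v.+2]].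
have WsL : (#|Ws| <= n ^ v)%N.
  pose f (W : {set 'I_n}) := W :\ i :\ j.
  have f_inj : {in Ws &, injective f}.
    move=> W W'; rewrite !inE => /and3P[iW jW _] /and3P[iW' jW' _] fE.
    by rewrite -(setD1K iW) -(setD1K iW') -[W :\ i](@setD1K _ j) -1?[W' :\
      i](@setD1K _ j)
      -/(f W) -/(f W') ?fE // !inE eq_sym ij.
  rewrite -(card_in_imset f_inj).
  apply: (@leq_trans #|[set B : {set 'I_n} | B \subset [set: 'I_n] & #|B| ==
    v]|).
    apply/subset_leq_card/subsetP => B /imsetP[W];
      rewrite !inE => /and3P[iW jW /eqP Wv] ->.
    rewrite subsetT /= /f; have jWi : j \in W :\ i by rewrite !inE eq_sym ij.
    by move: Wv; rewrite (cardsD1 i W) iW (cardsD1 j (W :\ i)) jWi !add1n =>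
      /eqP.
  rewrite cards_draws cardsT card_ord.
  exact: bin_le_expn.
set A := [set T | _].
have AS : A \subset \bigcup_(W in Ws) [set T : {set edge n} |
    T \subset [set e in upper n | (e.1 \in W) && (e.2 \in W)] & #|T| == d].
  apply/subsetP => T; rewrite inE => /and3P[TU Td Tv].
  apply/bigcupP; exists (verts i j T); first by rewrite !inE !eqxx ?orbT Tv.
  rewrite inE Td andbT; apply/subsetP => e eT; have eU := subsetP TU _ eT.
  rewrite inE eU /=; apply/andP; split; rewrite !inE.
    by apply/orP; left; apply/orP; right; apply: imset_f.
  by apply/orP; right; apply: imset_f.
apply: leq_trans (subset_leq_card AS) _.
apply: leq_trans (card_bigcup_le _ _) _.
apply: (@leq_trans (\sum_(W in Ws) 'C(v.+2, 2) ^ d)).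
  apply: leq_sum => W; rewrite inE => /and3P[_ _ /eqP Wv].
  rewrite cards_draws card_upper_within Wv.
  exact: bin_le_expn.
by rewrite sum_nat_const leq_mul2r WsL orbT.
Qed.

Lemma card_verts_ge2 n (i j : 'I_n) (T : {set edge n}) : i != j ->
  (2 <= #|verts i j T|)%N.
Proof.
move=> ij; apply: (@leq_trans #|[set i; j]|); first by rewrite cards2 ij.
by apply: subset_leq_card; rewrite /verts -setUA subsetUl.
Qed.

Lemma sum_arith_geom_le (R : realFieldType) D :
  \sum_(e < D) (e.+1%:R * 4 ^- e) <= 2 :> R.
Proof.
(* The subtracted tail lets the induction close, with slack [D * 4 ^- D / 2] at each step. *)
suff : \sum_(e < D) (e.+1%:R * 4 ^- e) <= 2 - (2 * D%:R + 2) * 4 ^- D :> R.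
  by move/le_trans; apply; rewrite gerBl mulr_ge0 ?addr_ge0 ?mulr_ge0
    ?invr_ge0 ?exprn_ge0.
elim: D => [|D IH]; first by rewrite big_ord0 expr0 invr1; lra.
rewrite big_ord_recr /=; apply: le_trans (lerD IH (lexx _)) _.
rewrite exprS invfM -[D.+1%:R]natr1.
rewrite -subr_ge0 [leRHS](_ : _ = D%:R * 4 ^- D / 2); last first.
  by move: (4 ^- D) (D%:R) => x d; field.
by rewrite !mulr_ge0 ?invr_ge0 ?exprn_ge0.
Qed.

Lemma edge_set_weight_le (R : realFieldType) n D (i j : 'I_n) : i != j ->
  \sum_(T : {set edge n} | [&& T \subset upper n, T != set0, (#|T| <= D)%N
      & (#|verts i j T|.-1 <= #|T|)%N])
    (2 * (D%:R + 1) ^+ 2) ^- #|T| * n%:R ^- #|verts i j T|.-1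
  <= 1 / (2 * n%:R) :> R.
Proof.
move=> ij; have n0 : (0 < n)%N by apply: leq_ltn_trans (ltn_ord i).
case: D => [|D].
  rewrite big_pred0 => [|T]; first by rewrite divr_ge0 ?mulr_ge0.
  by rewrite leqn0 cards_eq0; case: (T == set0); rewrite ?andbF.
(* Classes are indexed by [d = #|T| - 1] and [u = #|verts i j T| - 2]. The count [n ^ u] cancels all
   but one factor of [n ^- u.+1], and each class weighs at most [4 ^- d.+1 / n]. *)
rewrite (partition_big (fun T : {set edge n} => (inord #|T|.-1 : 'I_D.+1,
  inord (#|verts i j T|.-2) : 'I_D.+1)) (fun du => du.2 <= du.1)%N) /=;
    last first.
  move=> T /and4P[_ Tn TD vT]; have := card_verts_ge2 T ij.
  have : (0 < #|T|)%N by rewrite card_gt0.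
  by move=> T0 v2; rewrite !inordK; lia.
have -> : 1 / (2 * n%:R) = 2 * (4 * n%:R)^-1 :> R.
  by field; rewrite pnatr_eq0 -lt0n.
apply: (@le_trans _ _ (\sum_(du : 'I_D.+1 * 'I_D.+1 | (du.2 <= du.1)%N) 4 ^-
  du.1 * (4 * n%:R)^-1)).
  apply: ler_sum => -[d u] /= ud.
  pose y : R := (2 * (D.+1%:R + 1) ^+ 2)^-1.
  rewrite (eq_bigr (fun=> y ^+ d.+1 * n%:R ^- u.+1)) => [|T]; last first.
    move=> /andP[/and4P[_ Tn TD vT] /eqP[]] /(congr1 val) /= + /(congr1 val) /=.
    have := card_verts_ge2 T ij; have : (0 < #|T|)%N by rewrite card_gt0.
    move=> T0 v2; rewrite !inordK; try lia.
    move=> <- <-; rewrite /y exprVn; congr (_ ^- _ * _ ^- _).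
      by rewrite prednK.
    by case: #|verts i j T| v2 => [|[]].
  rewrite -(eq_bigl _ _ (in_set _)) sumr_const -[leLHS]mulr_natl.
  apply: (@le_trans _ _ ((n ^ u * 'C(u.+2, 2) ^ d.+1)%N%:R * (y ^+ d.+1 / n%:R
    ^+ u.+1))).
    have y0 : 0 <= y by rewrite invr_ge0 mulr_ge0 ?exprn_ge0 ?addr_ge0.
    rewrite ler_wpM2r ?divr_ge0 ?exprn_ge0 // ler_nat.
    apply: leq_trans (card_edge_sets_le _ _ ij);
      apply/subset_leq_card/subsetP => T.
    rewrite !inE => /andP[/and4P[-> Tn TD vT] /eqP[]] /(congr1 val) /= +
      /(congr1 val) /=.
    have := card_verts_ge2 T ij; have : (0 < #|T|)%N by rewrite card_gt0.
    move: {Tn} #|T| #|verts i j T| TD vT => a b TD vT T0 v2.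
    by rewrite !inordK; lia.
  have n0R : n%:R != 0 :> R by rewrite pnatr_eq0 -lt0n.
  rewrite natrM !natrX [X in X * _]mulrC mulrACA -exprMn [n%:R ^+ u.+1]exprS
    invfM.
  rewrite [_ ^+ u * _]mulrCA divff ?expf_neq0 // mulr1 invfM mulrA.
  rewrite ler_wpM2r ?invr_ge0 // -invfM -exprSr -exprVn.
  rewrite lerXn2r ?nnegrE ?mulr_ge0 ?invr_ge0 ?mulr_ge0 ?exprn_ge0 ?addr_ge0 //.
  rewrite /y ler_pdivrMr ?mulr_gt0 ?exprn_gt0 ?addr_gt0 //.
  (* The bound on edges is now [D.+1] and [u <= D], so each edge has at most [(D.+1 + 1) ^ 2 / 2]
     positions; times [y] this is at most 1/4. *)
  have : 'C(u.+2, 2)%:R * 2 <= (D.+1%:R + 1) ^+ 2 :> R.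
    rewrite natr1 -natrM -natrX ler_nat muln2.
    have uD : (u <= D)%N by rewrite -ltnS.
    have := bin_ffact u.+2 2; rewrite !ffactnS ffactn0 muln1 /= -muln2 => ->.
    rewrite -mulnn; nia.
  by lra.
rewrite -mulr_suml ler_wpM2r ?invr_ge0 ?mulr_ge0 //.
rewrite -(pair_big_dep xpredT (fun d u : 'I_D.+1 => (u <= d)%N) (fun d _ => 4
  ^- d)) /=.
apply: le_trans (sum_arith_geom_le R D.+1).
apply: ler_sum => d _.
have dD : (d <= D)%N by rewrite -ltnS.
by rewrite (big_ord_narrow_leq dD) sumr_const card_ord mulr_natl.
Qed.

(** The empty set contributes [k.+1 ^- 2], the square of its cumulant. Every other term is at most 4
    times its weight in [edge_set_weight_le]. *)
Lemma cumulant_sum_le (R : realType) n k D (i j : 'I_n) (x : R)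
    (c : {set edge n} -> R) : i != j -> (0 < D)%N -> 0 <= x ->
  x <= 1 / (2 * (D%:R * (D%:R + 1)) ^+ 2) * Num.min (k.+1%:R ^+ 2 / n%:R) 1 ->
  (forall T : {set edge n}, \sum_(S : {set edge n} | S \subset T)
    c S * mono_prob R k (T :\: S) = mono_prob R k ((i, j) |: T)) ->
  \sum_(T : {set edge n} | (T \subset upper n) && (#|T| <= D)%N)
    x ^+ #|T| * c T ^+ 2 <= k.+1%:R ^- 2 + 2 / n%:R.
Proof.
move=> ij D0 x0 xle c_eq.
have n0 : (0 < n)%N by apply: leq_ltn_trans (ltn_ord i).
have n0R : 0 < n%:R :> R by rewrite ltr0n.
have D0R : 0 < D%:R :> R by rewrite ltr0n.
rewrite (bigD1 set0) /=; last by rewrite sub0set cards0.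
apply: lerD.
  have := c_eq set0; rewrite (eq_bigl (pred1 set0)) => [|S];
    last by rewrite subset0.
  rewrite big_pred1_eq setDv mono_prob0 mulr1 setU0 => ->.
  by rewrite mono_prob_edge // cards0 expr0 mul1r exprVn.
set rho : R := 1 / (2 * (D%:R * (D%:R + 1)) ^+ 2) in xle *.
have rho0 : 0 <= rho.
  by rewrite divr_ge0 ?mulr_ge0 ?exprn_ge0 ?mulr_ge0 ?addr_ge0.
have x1 : x <= rho.
  by apply: le_trans xle _; rewrite ler_piMr // ge_min lexx orbT.
have x2 : x <= rho * (k.+1%:R ^+ 2 / n%:R).
  by apply: le_trans xle _; rewrite ler_wpM2l // ge_min lexx.
have -> : 2 / n%:R = 4 * (1 / (2 * n%:R)) :> R by field; rewrite gt_eqF.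
apply: le_trans (ler_wpM2l _ (@edge_set_weight_le R n D i j ij)) => //.
rewrite mulr_sumr (bigID (fun T => (#|verts i j T|.-1 <= #|T|)%N)) /=.
rewrite [X in _ + X]big1 ?addr0; last first.
  move=> T /andP[/andP[_ Tn] vT]; have [->|cT] := eqVneq (c T) 0.
    by rewrite expr0n mulr0.
  by rewrite (card_verts_le c_eq) in vT.
rewrite (eq_bigl (fun T : {set edge n} => [&& T \subset upper n, T != set0,
  (#|T| <= D)%N
      & (#|verts i j T|.-1 <= #|T|)%N])); last first.
  by move=> T; rewrite -!andbA; congr andb; rewrite andbCA.
apply: ler_sum => T /and4P[_ Tn TD vT].
set d := #|T| in TD vT *; set v := #|verts i j T|.-1 in vT *.
have cT2 : c T ^+ 2 <= 4 * (D%:R ^+ 2) ^+ d * (k.+1%:R ^+ 2) ^- v.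
  rewrite -real_normK ?num_real //.
  apply: (@le_trans _ _ ((2 * D%:R ^+ d * k.+1%:R ^- v) ^+ 2)).
    rewrite lerXn2r ?nnegrE ?normr_ge0 ?mulr_ge0 ?invr_ge0 ?exprn_ge0 //.
    apply: le_trans (cumulant_le c_eq Tn) _.
    rewrite ler_wpM2r ?invr_ge0 ?exprn_ge0 // ler_wpM2l // lerXn2r ?nnegrE //.
    by rewrite ler_nat.
  rewrite !exprMn exprVn [_ ^+ d ^+ 2]exprAC [_ ^+ v ^+ 2]exprAC !exprMn.
  by have -> : 2 ^+ 2 = 4 :> R by rewrite -natrX.
(* With [v <= d], use the bound of [x] by [rho * k.+1 ^ 2 / n] in [v] factors and by [rho] in the
   other [d - v]: this cancels exactly the [k.+1 ^ (2 v)] from the squared cumulant. *)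
have xd : x ^+ d <= rho ^+ d * (k.+1%:R ^+ 2 / n%:R) ^+ v.
  have y0 : 0 <= rho * (k.+1%:R ^+ 2 / n%:R) by apply: le_trans x2.
  rewrite -(subnK vT) !exprD -[leRHS]mulrA -exprMn.
  by apply: ler_pM; rewrite ?exprn_ge0 // lerXn2r ?nnegrE.
apply: le_trans (ler_pM _ _ xd cT2) _; rewrite ?sqr_ge0 ?exprn_ge0 //.
have K0 : (k.+1%:R ^+ 2) ^+ v != 0 :> R by rewrite !expf_neq0 // pnatr_eq0.
have nv : n%:R ^+ v != 0 :> R by rewrite expf_neq0 ?gt_eqF.
have -> : (2 * (D%:R + 1) ^+ 2) ^- d = (rho * D%:R ^+ 2) ^+ d :> R.
  by rewrite -exprVn /rho; congr (_ ^+ _); field; rewrite !gt_eqF ?addr_gt0.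
clearbody rho; move: (D%:R ^+ 2) (k.+1%:R ^+ 2) K0 => D2 K2 K0.
rewrite !exprMn !exprVn le_eqVlt; apply/orP; left; apply/eqP.
move: (rho ^+ d) (D2 ^+ d) (K2 ^+ v) (n%:R ^+ v) K0 nv => a b K N K0 N0.
by field; rewrite N0 K0.
Qed.

(** * Expectations over the graph given the labels *)

(** Independence of the entries: expanding the product of sums gives a sum over boolean functions
    supported above the diagonal, and symmetrising matches these with adjacency matrices. *)
Lemma graph_pmf_prod (R : realType) n (M : 'M[R]_n) (F : edge n -> bool -> R) :
  \sum_(A : 'M[bool]_n) graph_pmf M A *
      \prod_(e : edge n | (e.1 < e.2)%N) F e (A e.1 e.2) =
  \prod_(e : edge n | (e.1 < e.2)%N)
    (M e.1 e.2 * F e true + (1 - M e.1 e.2) * F e false).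
Proof.
pose G (e : edge n) (b : bool) : R :=
  (if b then M e.1 e.2 else 1 - M e.1 e.2) * F e b.
pose up (e : edge n) := (e.1 < e.2)%N.
transitivity (\prod_(e | up e) \sum_(b : bool) G e b); last first.
  by apply: eq_bigr => e _; rewrite big_bool.
rewrite (big_distr_big false) /=.
rewrite (bigID (@adjacency n)) /= [X in _ + X]big1 ?addr0; last first.
  by move=> A /negbTE nA; rewrite /graph_pmf nA mul0r.
pose toA (f : {ffun edge n -> bool}) : 'M[bool]_n :=
  \matrix_(i, j) (if (i < j)%N then f (i, j)
                  else if (j < i)%N then f (j, i) else false).
pose ofA (A : 'M[bool]_n) : {ffun edge n -> bool} :=
  [ffun e => up e && A e.1 e.2].
rewrite (reindex_onto toA ofA) /=; last first.
  move=> A /andP[/eqP At /forallP A0]; apply/matrixP => i j.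
  rewrite !mxE !ffunE /up /=; case: (ltngtP i j) => //= [ji|ij].
    by rewrite -[in RHS]At mxE.
  by have -> : i = j; [apply/val_inj | rewrite (negbTE (A0 j))].
apply: eq_big => [f|f /andP[adj _]]; last first.
  rewrite /graph_pmf adj -big_split; apply: eq_bigr => -[i j] /= ij.
  by rewrite mxE ij.
apply/andP/pffun_onP => [[_ /eqP <-]|[/subsetP fs _]].
  split; last by move=> b _.
  apply/subsetP => e; rewrite unfold_in /= ffunE -[e \in up]/(up e).
  by case: (up e).
split.
  apply/andP; split.
    by apply/eqP/matrixP => i j; rewrite !mxE; case: ltngtP.
  by apply/forallP => i; rewrite mxE ltnn.
apply/eqP/ffunP => -[i j]; rewrite ffunE mxE /up /=.
case: ifPn => //= ij; apply/esym/negbTE/negP => fij.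
have := fs (i, j); rewrite !inE /= fij => /(_ isT).
by rewrite unfold_in /= (negbTE ij).
Qed.

Lemma prod_upperE (R : comPzSemiRingType) n (T : {set edge n})
    (F : edge n -> R) :
  T \subset upper n ->
  \prod_(e in T) F e =
    \prod_(e : edge n | (e.1 < e.2)%N) (if e \in T then F e else 1).
Proof.
move=> /subsetP TU; rewrite -big_mkcondr; apply: eq_bigl => e.
case eT: (e \in T); rewrite ?andbF // andbT.
by have := TU e eT; rewrite inE.
Qed.

(** Each factor is the score of a Bernoulli variable, the derivative of its log-likelihood in the
    mean. *)
Definition edge_score (R : realType) n (M : 'M[R]_n) (S : {set edge n})
    (A : 'M[bool]_n) : R :=
  \prod_(e in S) (((A e.1 e.2)%:R - M e.1 e.2) / (M e.1 e.2 * (1 - M e.1 e.2))).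

Section GraphExpectation.
Context (R : realType) (n : nat) (M : 'M[R]_n).
Hypothesis M01 : forall i j : 'I_n, (i < j)%N -> 0 < M i j < 1.
Implicit Types S T : {set edge n}.

(** Edge by edge, the score has mean 0 and its product with [A_e - q] has mean 1, so every edge of
    [S] must be matched in [T]. *)
Lemma graph_mean_score (q : R) S T : S \subset upper n -> T \subset upper n ->
  \sum_(A : 'M[bool]_n) graph_pmf M A *
    (\prod_(e in T) ((A e.1 e.2)%:R - q) * edge_score M S A) =
  if S \subset T then \prod_(e in T :\: S) (M e.1 e.2 - q) else 0.
Proof.
move=> SU TU; pose F (e : edge n) (b : bool) : R := (if e \in T then b%:R - q
  else 1) *
  (if e \in S then (b%:R - M e.1 e.2) / (M e.1 e.2 * (1 - M e.1 e.2)) else 1).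
rewrite (eq_bigr (fun A => graph_pmf M A *
    \prod_(e : edge n | (e.1 < e.2)%N) F e (A e.1 e.2))); last first.
  by move=> A _; rewrite /edge_score !prod_upperE // -big_split.
rewrite graph_pmf_prod.
have FE (e : edge n) : (e.1 < e.2)%N -> M e.1 e.2 * F e true + (1 - M e.1 e.2)
  * F e false =
    if e \in S then (e \in T)%:R else if e \in T then M e.1 e.2 - q else 1.
  move=> /M01/andP[m0 m1]; rewrite /F.
  have m1' : 1 - M e.1 e.2 != 0 by rewrite subr_eq0 gt_eqF.
  have m0' : M e.1 e.2 != 0 by rewrite gt_eqF.
  by case: (e \in S); case: (e \in T) => /=; field; rewrite ?m0' ?m1'.
rewrite (eq_bigr _ FE); case: ifPn => [ST|/subsetPn[e eS eT]].
  rewrite prod_upperE; last by apply: subset_trans TU; apply: subsetDl.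
  apply: eq_bigr => e _; rewrite inE.
  by case: ifPn => //= /(subsetP ST) ->.
rewrite (bigD1 e) /=; last by have := subsetP SU e eS; rewrite inE.
by rewrite eS (negbTE eT) mul0r.
Qed.

Lemma graph_score_orthogonal S T : S \subset upper n -> T \subset upper n ->
  \sum_(A : 'M[bool]_n) graph_pmf M A * (edge_score M T A * edge_score M S A) =
  if S == T then \prod_(e in S) (M e.1 e.2 * (1 - M e.1 e.2))^-1 else 0.
Proof.
move=> SU TU; pose G (e : edge n) (b : bool) : R :=
  (b%:R - M e.1 e.2) / (M e.1 e.2 * (1 - M e.1 e.2)).
pose F (e : edge n) (b : bool) : R := (if e \in T then G e b else 1) *
  (if e \in S then G e b else 1).
rewrite (eq_bigr (fun A => graph_pmf M A *
    \prod_(e : edge n | (e.1 < e.2)%N) F e (A e.1 e.2))); last first.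
  by move=> A _; rewrite /edge_score !prod_upperE // -big_split.
rewrite graph_pmf_prod.
have FE (e : edge n) : (e.1 < e.2)%N -> M e.1 e.2 * F e true + (1 - M e.1 e.2)
  * F e false =
    if (e \in S) == (e \in T) then
      (if e \in S then (M e.1 e.2 * (1 - M e.1 e.2))^-1 else 1) else 0.
  move=> /M01/andP[m0 m1]; rewrite /F /G.
  have m1' : 1 - M e.1 e.2 != 0 by rewrite subr_eq0 gt_eqF.
  have m0' : M e.1 e.2 != 0 by rewrite gt_eqF.
  by case: (e \in S); case: (e \in T) => /=; field; rewrite ?m0' ?m1'.
rewrite (eq_bigr _ FE); case: eqVneq => [->|neST].
  by rewrite prod_upperE //; apply: eq_bigr => e _; rewrite eqxx.
have [e eST] : exists e, (e \in S) != (e \in T).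
  apply/existsP; apply: contra_neqT neST; rewrite negb_exists => /forallP H.
  by apply/setP => e; have := H e; rewrite negbK => /eqP.
rewrite (bigD1 e) /= ?(negbTE eST) ?mul0r //.
case eS: (e \in S); first by have := subsetP SU e eS; rewrite inE.
case eT: (e \in T); first by have := subsetP TU e eT; rewrite inE.
by rewrite eS eT in eST.
Qed.

End GraphExpectation.

(** * The dual certificate and the risk of one entry *)

Lemma labels_pmf_mono (R : realType) n k (T : {set edge n}) :
  \sum_(z : labels n k.+1) labels_pmf R z * \prod_(e in T) (z e.1 == z e.2)%:R =
  mono_prob R k T.
Proof.
pose f (x : 'rV['I_k.+1]_n) : labels n k.+1 := [ffun i => x ord0 i].
pose g (z : labels n k.+1) : 'rV['I_k.+1]_n := \row_i z i.
rewrite (reindex f) /=; last first.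
  exists g => [x _|z _]; first by apply/rowP => i; rewrite mxE ffunE.
  by apply/ffunP => i; rewrite ffunE mxE.
rewrite /labels_pmf prodr_const card_ord -mulr_sumr mulrC exprVn; congr (_ / _).
rewrite -sum1_card natr_sum [RHS]big_mkcond /=; apply: eq_bigr => x _.
case: ifPn => [/monoP H|].
  by apply: big1 => e eT; rewrite !ffunE H // eqxx.
rewrite inE negb_forall => /existsP[e];
  rewrite negb_imply => /andP[eT /negbTE xe].
by rewrite (bigD1 e) //= !ffunE xe mul0r.
Qed.

Section Duality.
Context (R : realType) (n k D : nat) (p q : R) (i j : 'I_n).
Hypotheses (q0 : 0 < q) (qp : q < p) (p1 : p < 1) (ij : (i < j)%N).
Context (c : {set edge n} -> R).
Hypothesis c_eq : forall T : {set edge n},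
  \sum_(S : {set edge n} | S \subset T) c S * mono_prob R k (T :\: S) =
    mono_prob R k ((i, j) |: T).
Implicit Types (S T : {set edge n}) (z : labels n k.+1) (A : 'M[bool]_n).

Local Notation Ex := (@sbm_expectation R n k.+1 p q).
Local Notation M := (sbm_mean p q).
Local Notation small :=
  (fun S : {set edge n} => (S \subset upper n) && (#|S| <= D)%N).

Definition same z : R := (z i == z j)%:R.

(** The power of [p - q] matches [M_e - q = (p - q) 1(z_a = z_b)] for [e = (a, b)], so that [p] and
    [q] drop out of the equations for [c]. *)
Definition dual_witness z A : R :=
  \sum_(S : {set edge n} | (S \subset upper n) && (#|S| <= D)%N)
    (p - q) ^+ #|S| * c S * edge_score (M z) S A.

Lemma sbm_expectationE F :
  Ex F = \sum_z labels_pmf R z * \sum_A graph_pmf (M z) A * F z A.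
Proof.
apply: eq_bigr => z _; rewrite mulr_sumr; apply: eq_bigr => A _.
by rewrite mulrA.
Qed.

Lemma sbm_expectation_eq F G :
  (forall z A, adjacency A -> F z A = G z A) -> Ex F = Ex G.
Proof.
move=> FG; apply: eq_bigr => z _; apply: eq_bigr => A _.
rewrite /graph_pmf; case: ifPn => [adj|_]; last by rewrite mulr0 !mul0r.
by rewrite FG.
Qed.

Lemma sbm_expectationD F G : Ex (fun z A => F z A + G z A) = Ex F + Ex G.
Proof.
rewrite -big_split; apply: eq_bigr => z _ /=; rewrite -big_split.
by apply: eq_bigr => A _; rewrite mulrDr.
Qed.

Lemma sbm_expectationZ a F : Ex (fun z A => a * F z A) = a * Ex F.
Proof.
rewrite mulr_sumr; apply: eq_bigr => z _; rewrite mulr_sumr.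
by apply: eq_bigr => A _; rewrite mulrCA.
Qed.

Lemma sbm_expectation_sum (I : Type) (r : seq I) (P : pred I) F :
  Ex (fun z A => \sum_(l <- r | P l) F l z A) = \sum_(l <- r | P l) Ex (F l).
Proof.
rewrite exchange_big; apply: eq_bigr => z _ /=.
rewrite exchange_big; apply: eq_bigr => A _ /=.
by rewrite mulr_sumr.
Qed.

Lemma sbm_expectation_ge0 F : (forall z A, 0 <= F z A) -> 0 <= Ex F.
Proof.
move=> F0; apply: sumr_ge0 => z _; apply: sumr_ge0 => A _.
rewrite !mulr_ge0 ?graph_pmf_ge0 ?(ltW q0) ?(ltW qp) ?(ltW p1) //.
by apply: prodr_ge0 => l _; rewrite invr_ge0.
Qed.

Lemma sbm_mean_upper z (a b : 'I_n) : (a < b)%N ->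
  M z a b = if z a == z b then p else q.
Proof.
by move=> ab; rewrite mxE; case: eqVneq ab => [->|//]; rewrite ltnn.
Qed.

Lemma sbm_mean01 z (a b : 'I_n) : (a < b)%N -> 0 < M z a b < 1.
Proof.
move=> ab; rewrite sbm_mean_upper //.
by case: ifP => _; rewrite ?q0 ?p1 ?(lt_trans q0 qp) ?(lt_trans qp p1).
Qed.

Lemma prod_mean_sub z T : T \subset upper n ->
  \prod_(e in T) (M z e.1 e.2 - q) =
    (p - q) ^+ #|T| * \prod_(e in T) (z e.1 == z e.2)%:R.
Proof.
move=> TU; rewrite -prodr_const -big_split; apply: eq_bigr => e /(subsetP TU).
rewrite inE => e12; rewrite sbm_mean_upper //.
by case: ifP => _ /=; rewrite ?mulr1 ?mulr0 ?subrr.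
Qed.

Lemma same_prod z T : same z * \prod_(e in T) (z e.1 == z e.2)%:R =
  \prod_(e in (i, j) |: T) (z e.1 == z e.2)%:R.
Proof.
have [ijT|ijT] := boolP ((i, j) \in T); last by rewrite big_setU1.
rewrite (setUidPr _) ?sub1set // (bigD1 (i, j)) //= /same.
by case: eqP; rewrite ?mul1r ?mul0r.
Qed.

(** Both sides equal [(p - q) ^ #|T|] times a side of the cumulant equation for [T]. Truncation at
    [D] loses nothing, since subsets of a small set are small. *)
Lemma dual_witness_centered T : small T ->
  Ex (fun z A => \prod_(e in T) ((A e.1 e.2)%:R - q) * dual_witness z A) =
  Ex (fun z A => \prod_(e in T) ((A e.1 e.2)%:R - q) * same z).
Proof.
move=> /andP[TU TD]; rewrite !sbm_expectationE.
transitivity ((p - q) ^+ #|T| * mono_prob R k ((i, j) |: T)); last first.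
  rewrite -labels_pmf_mono mulr_sumr; apply: eq_bigr => z _.
  rewrite mulrCA; congr (_ * _); rewrite -same_prod.
  have := graph_mean_score (@sbm_mean01 z) q (sub0set _) TU.
  rewrite sub0set setD0 prod_mean_sub // mulrCA => <-.
  rewrite mulr_sumr; apply: eq_bigr => A _.
  by rewrite /edge_score big_set0 mulr1 mulrCA [same z * _]mulrC.
rewrite -c_eq mulr_sumr.
transitivity (\sum_(z : labels n k.+1) \sum_(S : {set edge n} | S \subset T)
  (p - q) ^+ #|T| *
   (c S * (labels_pmf R z * \prod_(e in T :\: S) (z e.1 == z e.2)%:R)));
     last first.
  rewrite exchange_big; apply: eq_bigr => S _ /=.
  by rewrite -labels_pmf_mono !mulr_sumr.
apply: eq_bigr => z _.
rewrite (_ : \sum_A _ = \sum_(S | small S) (p - q) ^+ #|S| * c S *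
    \sum_(A : 'M[bool]_n) graph_pmf (M z) A *
      (\prod_(e in T) ((A e.1 e.2)%:R - q) * edge_score (M z) S A)); last first.
  under [RHS]eq_bigr => S _ do rewrite mulr_sumr.
  rewrite [RHS]exchange_big; apply: eq_bigr => A _ /=.
  rewrite /dual_witness !mulr_sumr; apply: eq_bigr => S _.
  by ring.
rewrite mulr_sumr (bigID (fun S => S \subset T)) /= addrC big1 ?add0r;
  last first.
  move=> S /andP[/andP[SU _] /negbTE nST].
  by rewrite (graph_mean_score (@sbm_mean01 z)) // nST !mulr0.
apply: eq_big => S; last first.
  move=> /andP[/andP[SU _] ST].
  rewrite (graph_mean_score (@sbm_mean01 z)) // ST prod_mean_sub; last first.
    exact: subset_trans (subsetDl _ _) TU.
  rewrite (_ : #|T| = #|S| + #|T :\: S|)%N ?exprD; first by ring.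
  by rewrite -(cardsID S T) (setIidPr ST).
case ST: (S \subset T); rewrite ?andbF // andbT (subset_trans ST TU).
exact: leq_trans (subset_leq_card ST) TD.
Qed.

(** Writing [A_e = (A_e - q) + q] for an edge of [S] either moves it to [T] or drops it, which
    reduces to centered products. *)
Lemma dual_witness_edges S T : [disjoint S & T] -> S \subset upper n ->
  T \subset upper n -> (#|S| + #|T| <= D)%N ->
  Ex (fun z A =>
    \prod_(e in S) (A e.1 e.2)%:R * \prod_(e in T) ((A e.1 e.2)%:R - q)
    * (dual_witness z A - same z)) = 0.
Proof.
have [d] := ubnP #|S|; elim: d S T => // d IH S T;
  rewrite ltnS => Sd dis SU TU STD.
have [S0|[e eS]] := set_0Vmem S.
  rewrite S0 cards0 in STD *.
  rewrite (@sbm_expectation_eq _ (fun z A =>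
      \prod_(e in T) ((A e.1 e.2)%:R - q) * dual_witness z A +
      -1 * (\prod_(e in T) ((A e.1 e.2)%:R - q) * same z))); last first.
    by move=> z A _; rewrite big_set0; ring.
  rewrite sbm_expectationD sbm_expectationZ dual_witness_centered ?TU //.
  by rewrite mulN1r subrr.
have eU := subsetP SU e eS; rewrite inE in eU.
have eT : e \notin T by rewrite (disjointFr dis eS).
have eTU : e |: T \subset upper n by rewrite subUset sub1set inE eU TU.
have SeU : S :\ e \subset upper n by apply: subset_trans SU; apply: subsetDl.
have cS : #|S| = #|S :\ e|.+1 by rewrite (cardsD1 e) eS.
have dis' : [disjoint S :\ e & T] by apply: disjointWl dis; apply: subsetDl.
rewrite (@sbm_expectation_eq _ (fun z A =>
    \prod_(f in S :\ e) (A f.1 f.2)%:R * \prod_(f in e |: T) ((A f.1 f.2)%:R -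
      q) *
      (dual_witness z A - same z) +
    q * (\prod_(f in S :\ e) (A f.1 f.2)%:R * \prod_(e in T) ((A e.1 e.2)%:R -
      q) *
      (dual_witness z A - same z)))); last first.
  move=> z A _; rewrite big_setU1 //= (big_setD1 e) //=.
  set X := \prod_(_ in S :\ e) _; set Y := \prod_(_ in T) _; ring.
rewrite sbm_expectationD sbm_expectationZ !IH ?mulr0 ?addr0 //.
- by rewrite -cS.
- by apply: leq_trans STD; rewrite cS addSn ltnW.
- by rewrite -cS.
- rewrite disjoint_sym -setI_eq0; apply/eqP/setP => e'; rewrite !inE.
  case: eqVneq => //= _; rewrite andbC.
  by case eS' : (e' \in S); rewrite ?(disjointFr dis eS').
- by rewrite cardsU1 eT addnCA add1n -addSn -cS.
Qed.

Definition entries A := mxvec (map_mx (fun b : bool => b%:R : R) A) ord0.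

(** On adjacency matrices a diagonal variable vanishes, mirrored variables coincide and powers
    collapse as [A_e ^ 2 = A_e]; none of this raises the degree. *)
Lemma meval_monomial (m : 'X_{1.. n * n}) :
  (forall A, adjacency A -> ('X_[R, m]).@[entries A] = 0) \/
  exists S, [/\ S \subset upper n, (#|S| <= mdeg m)%N &
    forall A, adjacency A ->
      ('X_[R, m]).@[entries A] = \prod_(e in S) (A e.1 e.2)%:R].
Proof.
have [d] := ubnP (mdeg m); elim: d m => // d IH m; rewrite ltnS => md.
have [->|mn] := eqVneq m 0%MM.
  right; exists set0; split=> [||A _]; rewrite ?sub0set ?cards0 //.
  by rewrite mpolyX0 meval1 big_set0.
have [l ml] : exists l, m l != 0%N.
  apply/existsP; apply: contra_neqT mn; rewrite negb_exists => /forallP H.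
  by apply/mnmP => l; have := H l; rewrite negbK mnm0E => /eqP.
have mE : m = (U_(l) + (m - U_(l)))%MM by rewrite addmC submK // lep1mP.
have mdE : mdeg m = (mdeg (m - U_(l))%MM).+1 by rewrite {1}mE mdegD mdeg1 add1n.
have XE A : ('X_[R, m]).@[entries A] =
    entries A l * ('X_[R, (m - U_(l))%MM]).@[entries A].
  by rewrite {1}mE mpolyXD mevalM mevalXU.
have [|H|[S [SU Sm H]]] := IH (m - U_(l))%MM; first by rewrite -mdE.
  by left=> A adj; rewrite XE H // mulr0.
case/mxvec_indexP: l => a b in ml mE mdE XE Sm H *.
have EA A : entries A (mxvec_index a b) = (A a b)%:R by rewrite /entries
  mxvecE mxE.
have {EA} [a_b|[e [eU EA]]] : a = b \/ exists e : edge n, (e.1 < e.2)%N /\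
    forall A, adjacency A -> entries A (mxvec_index a b) = (A e.1 e.2)%:R.
  have [ab|ba|/val_inj ab] := ltngtP a b; last by left.
    by right; exists (a, b); split=> // A _; rewrite EA.
  right; exists (b, a); split=> // A /andP[/eqP At _]; rewrite EA.
  by rewrite -{1}At mxE.
  left=> A /andP[_ /forallP/(_ b) Abb].
  by rewrite XE /entries mxvecE mxE a_b (negbTE Abb) mul0r.
right; have [eS|eS] := boolP (e \in S).
  exists S; split=> // [|A adj]; first by rewrite mdE ltnW.
  rewrite XE H // EA // (bigD1 e) //= mulrA -natrM mulnb andbb.
  by [].
exists (e |: S); split=> [||A adj].
- by rewrite subUset sub1set inE eU SU.
- by rewrite cardsU1 eS mdE.
- by rewrite XE H // EA // big_setU1.
Qed.

Lemma dual_witness_poly (P : {mpoly R[n * n]}) : (msize P <= D.+1)%N ->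
  Ex (fun z A => P.@[entries A] * (dual_witness z A - same z)) = 0.
Proof.
move=> PD; rewrite (@sbm_expectation_eq _ (fun z A => \sum_(m <- msupp P)
    P@_m * (('X_[R, m]).@[entries A] * (dual_witness z A - same z))));
      last first.
  move=> z A _; rewrite {1}[P]mpolyE raddf_sum mulr_suml;
    apply: eq_bigr => m _ /=.
  by rewrite mevalZ mulrA.
rewrite sbm_expectation_sum big_seq big1 // => m mP.
rewrite sbm_expectationZ; have [H|[S [SU Sm H]]] := meval_monomial m.
  rewrite (@sbm_expectation_eq _ (fun z A => 0 * (0 : R))).
    by rewrite sbm_expectationZ mul0r mulr0.
  by move=> z A adj; rewrite H // !mul0r.
rewrite (@sbm_expectation_eq _ (fun z A => \prod_(e in S) (A e.1 e.2)%:R *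
    \prod_(e in (set0 : {set edge n})) ((A e.1 e.2)%:R - q) * (dual_witness z
      A - same z))).
  rewrite dual_witness_edges ?mulr0 ?sub0set ?cards0 ?addn0 //.
    by rewrite -setI_eq0 setI0.
  by rewrite (leq_trans Sm) // -ltnS (leq_trans (msize_mdeg_lt mP)).
by move=> z A adj; rewrite H // big_set0 mulr1.
Qed.

Lemma expectation_same_sqr : Ex (fun z A => same z ^+ 2) = k.+1%:R^-1.
Proof.
rewrite sbm_expectationE -(@mono_prob_edge R n k i j); last first.
  by apply: contraTneq ij => ->; rewrite ltnn.
rewrite -[X in mono_prob _ _ X]setU0 -labels_pmf_mono; apply: eq_bigr => z _.
rewrite -mulr_suml graph_pmf_sum1 mul1r -same_prod big_set0 mulr1.
by rewrite /same; case: eqP; rewrite ?expr1n ?expr0n.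
Qed.

(** Orthogonality leaves the diagonal terms, and each edge variance [M_e (1 - M_e)] is at least
    [q (1 - p)]. *)
Lemma dual_witness_sqr_le : Ex (fun z A => dual_witness z A ^+ 2) <=
  \sum_(S | small S) ((p - q) ^+ 2 / (q * (1 - p))) ^+ #|S| * c S ^+ 2.
Proof.
have p1' : 0 < 1 - p by rewrite subr_gt0.
rewrite sbm_expectationE.
apply: (@le_trans _ _ (\sum_(z : labels n k.+1) labels_pmf R z *
   \sum_(S | small S) ((p - q) ^+ 2 / (q * (1 - p))) ^+ #|S| * c S ^+ 2));
     last first.
  by rewrite -mulr_suml labels_pmf_sum1 // mul1r.
apply: ler_sum => z _; rewrite ler_wpM2l //; first by apply: prodr_ge0 => l _;
  rewrite invr_ge0.
rewrite (_ : \sum_A _ = \sum_(S | small S) \sum_(T | small T)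
    ((p - q) ^+ #|S| * c S) * ((p - q) ^+ #|T| * c T) *
    \sum_(A : 'M[bool]_n) graph_pmf (M z) A *
      (edge_score (M z) T A * edge_score (M z) S A)); last first.
  under [RHS]eq_bigr => S _ do under eq_bigr => T _ do rewrite mulr_sumr.
  under [RHS]eq_bigr => S _ do rewrite exchange_big /=.
  rewrite [RHS]exchange_big /=; apply: eq_bigr => A _.
  rewrite /dual_witness expr2 mulr_suml mulr_sumr; apply: eq_bigr => S _.
  rewrite !mulr_sumr; apply: eq_bigr => T _.
  by ring.
apply: ler_sum => S SS; have /andP[SU _] := SS.
rewrite (bigD1 S) //= [X in _ + X]big1 ?addr0; last first.
  move=> T /andP[/andP[TU _] TS].
  by rewrite (graph_score_orthogonal (@sbm_mean01 z)) // eq_sym (negbTE TS)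
    mulr0.
rewrite (graph_score_orthogonal (@sbm_mean01 z)) // eqxx -expr2 exprMn mulrAC.
rewrite ler_wpM2r ?sqr_ge0 // exprAC [leRHS]exprMn.
rewrite ler_wpM2l ?exprn_ge0 ?subr_ge0 ?(ltW qp) // -prodr_const;
  apply: ler_prod => e eS.
have e12 : (e.1 < e.2)%N by have := subsetP SU e eS; rewrite inE.
have /andP[m0 m1] := sbm_mean01 z e12.
rewrite invr_ge0 ltW ?mulr_gt0 ?subr_gt0 //=.
rewrite lef_pV2 ?posrE ?mulr_gt0 ?subr_gt0 // sbm_mean_upper //.
have := ltW qp => qp'.
by case: ifP => _; rewrite ler_pM ?(ltW q0) ?(ltW p1') // lerD2l lerN2.
Qed.

Lemma edge_risk_ge (P : {mpoly R[n * n]}) : (msize P <= D.+1)%N ->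
  k.+1%:R^-1 -
    \sum_(S | small S) ((p - q) ^+ 2 / (q * (1 - p))) ^+ #|S| * c S ^+ 2
    <= Ex (fun z A => (P.@[entries A] - same z) ^+ 2).
Proof.
move=> PD.
rewrite (@sbm_expectation_eq _ (fun z A => (P.@[entries A] - dual_witness z A)
  ^+ 2 +
  (2 * (P.@[entries A] * (dual_witness z A - same z)) +
  (same z ^+ 2 + -1 * dual_witness z A ^+ 2)))); last by move=> z A _; ring.
rewrite !sbm_expectationD !sbm_expectationZ dual_witness_poly //.
rewrite expectation_same_sqr mulr0 add0r mulN1r.
apply: le_trans (lerD (sbm_expectation_ge0 _) (lexx _)); last by move=> *;
  apply: sqr_ge0.
by rewrite add0r lerD2l lerN2 dual_witness_sqr_le.
Qed.

End Duality.

(** * Averaging over pairs and conclusion *)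

Lemma card_upper n : #|upper n| = 'C(n, 2).
Proof.
rewrite -[n in RHS]card_ord -cardsT -card_upper_within; congr #|pred_of_set _|.
by apply/setP => e; rewrite !inE !andbT.
Qed.

Lemma risk_ge (R : realType) (n k D : nat) (p q : R) (P : poly_estimator R n) :
  (2 <= n)%N -> (0 < D)%N -> 0 < q -> q < p -> p < 1 ->
  (p - q) ^+ 2 / (q * (1 - p))
     <= 1 / (2 * (D%:R * (D%:R + 1)) ^+ 2) * Num.min (k.+1%:R ^+ 2 / n%:R) 1 ->
  low_degree D P ->
  k.+1%:R^-1 - (k.+1%:R ^- 2 + 2 / n%:R) <= risk k.+1 p q P.
Proof.
move=> n2 D0 q0 qp p1 snr PD; set b := (X in X <= _).
have edge_ge (e : edge n) : (e.1 < e.2)%N ->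
    b <= sbm_expectation p q (fun (z : labels n k.+1) A =>
      ((P e.1 e.2).@[entries R A] - same R e.1 e.2 z) ^+ 2).
  move=> e12; have e12' : e.1 != e.2 by apply: contraTneq e12 => ->;
    rewrite ltnn.
  have [c c_eq] := cumulants_exist (fun T => mono_prob R k ((e.1, e.2) |: T))
    (mono_prob0 R n k).
  apply: le_trans (edge_risk_ge q0 qp p1 e12 c_eq (PD _ _)).
  rewrite lerD2l lerN2; apply: cumulant_sum_le snr c_eq => //.
  by rewrite divr_ge0 ?sqr_ge0 // mulr_ge0 ?(ltW q0) // subr_ge0 ltW.
have C0 : 0 < 'C(n, 2)%:R :> R by rewrite ltr0n bin_gt0.
(* The loss is an average over pairs, so the bound for a single entry carries over. *)
have -> : risk k.+1 p q P = 'C(n, 2)%:R^-1 * \sum_(e : edge n | (e.1 < e.2)%N)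
    sbm_expectation p q (fun (z : labels n k.+1) A =>
      ((P e.1 e.2).@[entries R A] - same R e.1 e.2 z) ^+ 2).
  rewrite -sbm_expectation_sum -sbm_expectationZ.
  apply: sbm_expectation_eq => z A _; congr (_ * _).
  apply: eq_bigr => e e12; rewrite !mxE.
  by case: eqVneq e12 => [->|//]; rewrite ltnn.
rewrite ler_pdivlMl // -card_upper mulr_natl -sumr_const.
rewrite (eq_bigl (fun e : edge n => (e.1 < e.2)%N)) => [|e];
  last by rewrite inE.
exact: ler_sum.
Qed.

Theorem theorem5 (R : realType) (n k D : nat) (p q : R)
    (hn : (2 <= n)%N) (hk : (1 <= k)%N) (hD : (1 <= D)%N)
    (hq : 0 < q) (hqp : q < p) (hp : p < 1) :
  ((p - q) ^+ 2 / (q * (1 - p))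
     <= 1 / (2 * (D%:R * (D%:R + 1)) ^+ 2)
        * Num.min (k%:R ^+ 2 / n%:R) 1 ->
   inf [set risk k p q P | P in @low_degree R n D]%classic
     >= 1 / k%:R - 1 / k%:R ^+ 2 - 3 / n%:R)
  /\
  (k%:R <= Num.sqrt n%:R :> R ->
   n%:R * (p - q) ^+ 2 / (k%:R ^+ 2 * q * (1 - p))
     <= 1 / (2 * (D%:R * (D%:R + 1)) ^+ 2) ->
   inf [set risk k p q P | P in @low_degree R n D]%classic
     >= 1 / k%:R - 1 / k%:R ^+ 2 - 3 / n%:R).
Proof.
case: k hk => // k _.
have n0 : 0 < n%:R :> R by rewrite ltr0n (leq_trans _ hn).
have main : (p - q) ^+ 2 / (q * (1 - p))
     <= 1 / (2 * (D%:R * (D%:R + 1)) ^+ 2) * Num.min (k.+1%:R ^+ 2 / n%:R) 1 ->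
   inf [set risk k.+1 p q P | P in @low_degree R n D]%classic
     >= 1 / k.+1%:R - 1 / k.+1%:R ^+ 2 - 3 / n%:R.
  move=> snr; apply: lb_le_inf.
    by have [] := @risk_has_inf R n k.+1 D p q (ltW hq) (ltW hqp) (ltW hp).
  move=> _ [P PD <-]; apply: le_trans (risk_ge hn hD hq hqp hp snr PD).
  (* The certificate gives [2 / n], which is weakened to [3 / n]. *)
  rewrite !div1r opprD addrA lerD2l lerN2 ler_wpM2r ?invr_ge0 ?(ltW n0) //.
  by rewrite ler_nat.
split=> // kn snr; apply: main.
have K0 : 0 < k.+1%:R :> R by [].
have kn2 : k.+1%:R ^+ 2 <= n%:R :> R.
  by rewrite -[leRHS]sqr_sqrtr ?(ltW n0) // lerXn2r ?nnegrE ?sqrtr_ge0.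
(* As [k.+1 ^ 2 <= n] the minimum is [k.+1 ^ 2 / n]; dividing by it turns the condition into the
   rescaled one. *)
rewrite min_l; last by rewrite ler_pdivrMr ?mul1r.
rewrite -[leLHS](@divfK _ (k.+1%:R ^+ 2 / n%:R)); last first.
  by rewrite gt_eqF // divr_gt0 ?exprn_gt0.
rewrite ler_wpM2r ?divr_ge0 ?exprn_ge0 //; apply: le_trans snr.
rewrite le_eqVlt; apply/orP; left; apply/eqP.
by field; rewrite nat1r !gt_eqF ?subr_gt0.
Qed.
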